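(* Let $N\in\mathbb{N}$, let $\Omega\subseteq\mathbb{R}^N$ be a bounded domain with Lipschitz boundary $\partial\Omega$, let $1<q<p<N$ with $\frac{p}{q}<1+\frac1N$, and let $a\in C^{0,1}(\overline{\Omega})\cap A_p$ satisfy $a(x)>0$ for all $x\in\Omega$. Then any $\lambda\in(0,\hat\lambda_1]$ is not an eigenvalue of the problem $$-\mathrm{div}\big(a(x)|\nabla u|^{p-2}\nabla u\big)-\mathrm{div}\big(|\nabla u|^{q-2}\nabla u\big)=\lambda a(x)|u|^{p-2}u\ \text{ in }\Omega,\qquad u=0\ \text{ on }\partial\Omega.$$
   Context: $C^{0,1}(\overline\Omega)$ is the space of Lipschitz functions $\overline\Omega\to\mathbb{R}$; $A_p$ is the class of $p$-Muckenhoupt weights (on $\mathbb{R}^N$; $a\in A_p$ means that $a$ is the restriction to $\Omega$ of such a weight). Put $\Theta(x,t)=a(x)t^p+t^q$ and $\Theta_0(x,t)=a(x)t^p$ for $(x,t)\in\Omega\times[0,\infty)$. For $\Psi\in\{\Theta,\Theta_0\}$ and measurable $u:\Omega\to\mathbb{R}$ let $\rho_\Psi(u)=\int_\Omega\Psi(x,|u|)\,dx$; $L^\Psi(\Omega)$ is the space of measurable $u$ with $\rho_\Psi(u)<\infty$, with the Luxemburg norm $\|u\|_\Psi=\inf\{\mu>0:\rho_\Psi(u/\mu)\le1\}$; $W^{1,\Psi}(\Omega)=\{u\in L^\Psi(\Omega):|\nabla u|\in L^\Psi(\Omega)\}$ (weak gradient), with norm $\|u\|_\Psi+\|\nabla u\|_\Psi$;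 $W^{1,\Psi}_0(\Omega)$ is the subspace of functions with zero trace on $\partial\Omega$. Write $\rho_\Psi(\nabla u)=\rho_\Psi(|\nabla u|)$. On $W^{1,\Theta}_0(\Omega)$ the equivalent norm $\|\nabla u\|_\Theta$ is used. $\hat\lambda_1$ denotes the smallest eigenvalue of $-\mathrm{div}(a(x)|\nabla u|^{p-2}\nabla u)=\lambda a(x)|u|^{p-2}u$ in $\Omega$, $u=0$ on $\partial\Omega$ (weak eigenfunctions in $W^{1,\Theta_0}_0(\Omega)\setminus\{0\}$); it is known to exist, to be positive, and to be given by $$\hat\lambda_1=\inf\left\{\frac{\rho_{\Theta_0}(\nabla u)}{\rho_{\Theta_0}(u)}:u\in W^{1,\Theta_0}_0(\Omega),\ u\neq0\right\}.$$ A number $\lambda$ is an eigenvalue of the problem in the claim if it has a nontrivial weak solution, i.e. there is $u\in W^{1,\Theta}_0(\Omega)\setminus\{0\}$ with $\int_\Omega \big(a(x)|\nabla u|^{p-2}+|\nabla u|^{q-2}\big)\nabla u\cdot\nabla h\,dx=\lambda\int_\Omega a(x)|u|^{p-2}uh\,dx$ for all $h\in W^{1,\Theta}_0(\Omega)$. *)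

(* Defs.v *)
From HB Require Import structures.
From mathcomp Require Import all_boot all_order all_algebra.
From mathcomp Require Import all_classical all_reals all_analysis.

Set Implicit Arguments.
Unset Strict Implicit.
Unset Printing Implicit Defensive.

Import Order.TTheory GRing.Theory Num.Theory.
Import numFieldNormedType.Exports.

Local Open Scope classical_set_scope.
Local Open Scope ring_scope.

(* The library norm on ['rV[R]_N] is the sup norm: it serves for topology and
   Lipschitz continuity only. Lengths of gradients are Euclidean. *)
Definition dotv (R : realType) (N : nat) (u v : 'rV[R]_N) : R :=
  \sum_(i < N) u 0 i * v 0 i.

Definition enorm (R : realType) (N : nat) (u : 'rV[R]_N) : R :=
  Num.sqrt (dotv u u).

Section OuterMeasures.
Context (R : realType) (N : nat).

(* Infimum of the volumes of the closed boxes containing [A]; the case of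
   [set0] matters only for N = 0. *)
Definition box_volume (A : set 'rV[R]_N) : \bar R :=
  if A == set0 then 0%E
  else ereal_inf [set v | exists a b : 'rV[R]_N,
    [/\ forall i, a 0 i <= b 0 i,
        A `<=` [set x | forall i, a 0 i <= x 0 i <= b 0 i] &
        v = (\prod_(i < N) (b 0 i - a 0 i))%:E]].

(* [mu_ext] takes the infimum over countable covers by Borel sets. *)
Definition lebesgue_outer : set 'rV[R]_N -> \bar R :=
  @mu_ext _ (g_sigma_algebraType (@open 'rV[R]_N)) R box_volume.

Definition diam_pow (s : nat) (delta : R) (A : set 'rV[R]_N) : \bar R :=
  if A == set0 then 0%E
  else ereal_inf [set v | exists r : R,
    [/\ 0 < r <= delta,
        forall x y, A x -> A y -> enorm (x - y) <= r &
        v = (r ^+ s)%:E]].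

(* [s]-dimensional Hausdorff measure, without normalizing constant. *)
Definition hausdorff_outer (s : nat) (A : set 'rV[R]_N) : \bar R :=
  ereal_sup [set @mu_ext _ (g_sigma_algebraType (@open 'rV[R]_N)) R
                   (diam_pow s delta) A | delta in [set d : R | 0 < d]].

Lemma box_volume0 : box_volume set0 = 0%E.
Proof. by rewrite /box_volume eqxx. Qed.

Lemma box_volume_ge0 A : (0 <= box_volume A)%E.
Proof.
rewrite /box_volume; case: ifP => // _.
apply: le_ereal_inf_tmp => _ [a [b [ab _ ->]]].
by rewrite lee_fin; apply: prodr_ge0 => i _; rewrite subr_ge0.
Qed.

Lemma diam_pow0 s d : diam_pow s d set0 = 0%E.
Proof. by rewrite /diam_pow eqxx. Qed.

Lemma diam_pow_ge0 s d A : (0 <= diam_pow s d A)%E.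
Proof.
rewrite /diam_pow; case: ifP => // _.
apply: le_ereal_inf_tmp => _ [r [/andP[r0 _] _ ->]].
by rewrite lee_fin exprn_ge0 // ltW.
Qed.

Lemma lebesgue_outer0 : lebesgue_outer set0 = 0%E.
Proof. by apply: mu_ext0; [exact: box_volume0 | exact: box_volume_ge0]. Qed.

Lemma lebesgue_outer_ge0 A : (0 <= lebesgue_outer A)%E.
Proof. by apply: mu_ext_ge0; exact: box_volume_ge0. Qed.

Lemma le_lebesgue_outer :
  {homo lebesgue_outer : A B / A `<=` B >-> (A <= B)%E}.
Proof. by move=> A B AB; exact: le_mu_ext. Qed.

Lemma lebesgue_outer_sigma_subadditive : sigma_subadditive lebesgue_outer.
Proof. by move=> F; apply: mu_ext_sigma_subadditive; exact: box_volume_ge0. Qed.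

HB.instance Definition _ := isOuterMeasure.Build R 'rV[R]_N lebesgue_outer
  lebesgue_outer0 lebesgue_outer_ge0 le_lebesgue_outer
  lebesgue_outer_sigma_subadditive.

Lemma hausdorff_outer_ge0 s A : (0 <= hausdorff_outer s A)%E.
Proof.
apply: le_ereal_sup_tmp => /=.
exists (@mu_ext _ (g_sigma_algebraType (@open 'rV[R]_N)) R
  (diam_pow s 1) A); first by exists 1 => //=.
by apply: mu_ext_ge0; exact: diam_pow_ge0.
Qed.

Lemma hausdorff_outer0 s : hausdorff_outer s set0 = 0%E.
Proof.
apply/eqP; rewrite eq_le hausdorff_outer_ge0 andbT.
apply: ge_ereal_sup => _ [d _ <-].
by rewrite mu_ext0 //; [exact: diam_pow0 | exact: diam_pow_ge0].
Qed.

Lemma le_hausdorff_outer s :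
  {homo hausdorff_outer s : A B / A `<=` B >-> (A <= B)%E}.
Proof.
move=> A B AB; apply: ge_ereal_sup => _ [d d0 <-].
apply: le_ereal_sup_tmp; eexists; first by exists d.
exact: le_mu_ext.
Qed.

Lemma hausdorff_outer_sigma_subadditive s :
  sigma_subadditive (hausdorff_outer s).
Proof.
move=> F; apply: ge_ereal_sup => _ [d d0 <-].
apply: le_trans.
  by apply: mu_ext_sigma_subadditive; exact: diam_pow_ge0.
apply: lee_nneseries => i _.
  by move=> _; apply: mu_ext_ge0; exact: diam_pow_ge0.
by apply: ereal_sup_ubound; exists d.
Qed.

HB.instance Definition _ s := isOuterMeasure.Build R 'rV[R]_N
  (hausdorff_outer s) (hausdorff_outer0 s) (hausdorff_outer_ge0 s)
  (@le_hausdorff_outer s) (@hausdorff_outer_sigma_subadditive s).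

End OuterMeasures.

(* R^N with the sigma-algebra of Lebesgue measurable sets. *)
Notation Rn R N := (caratheodory_type (@lebesgue_outer R N)).

Definition leb (R : realType) (N : nat) : {measure set (Rn R N) -> \bar R} :=
  OuterMeasure.sort (@lebesgue_outer R N).

Definition hausdorff (R : realType) (N s : nat) :
    {measure set (caratheodory_type (@hausdorff_outer R N s)) -> \bar R} :=
  OuterMeasure.sort (@hausdorff_outer R N s).

Section Domains.
Context (R : realType) (N : nat).
Implicit Types Omega : set 'rV[R]_N.

Definition boundary Omega : set 'rV[R]_N := closure Omega `\` interior Omega.

Definition bounded_domain Omega : Prop :=
  [/\ open Omega, connected Omega, Omega !=set0 & bounded_set Omega].

(* Near each boundary point, in suitable orthonormal coordinates [y *m Q],
   the domain is the strict epigraph of a Lipschitz function of the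
   coordinates other than the [i]-th. *)
Definition lipschitz_boundary Omega : Prop :=
  forall x, boundary Omega x ->
  exists (r : R) (Q : 'M[R]_N) (i : 'I_N) (g : 'rV[R]_N.-1 -> R),
    [/\ 0 < r, Q *m Q^T = 1%:M, lipschitz g &
        forall y, ball x r y ->
          (Omega y <-> g (col' i (y *m Q)) < (y *m Q) 0 i)].

End Domains.

Section SmoothFunctions.
Context (R : realType) (N : nat).

Definition partial (i : 'I_N) (f : 'rV[R]_N -> R) : 'rV[R]_N -> R :=
  fun x => 'D_(delta_mx 0 i) f x.

Fixpoint Ck (k : nat) (f : 'rV[R]_N -> R) : Prop :=
  continuous f /\
  match k with
  | 0%N => True
  | k'.+1 => forall i : 'I_N,
      (forall x, derivable f x (delta_mx 0 i)) /\ Ck k' (partial i f)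
  end.

Definition smooth (f : 'rV[R]_N -> R) : Prop := forall k, Ck k f.

Definition test_function (Omega : set 'rV[R]_N) (phi : 'rV[R]_N -> R) : Prop :=
  smooth phi /\
  exists K : set 'rV[R]_N,
    [/\ compact K, K `<=` Omega & forall x, ~ K x -> phi x = 0].

End SmoothFunctions.

Section FunctionSpaces.
Context (R : realType) (N : nat).
Implicit Types (Omega : set 'rV[R]_N) (u : 'rV[R]_N -> R)
  (G : 'rV[R]_N -> 'rV[R]_N).
Local Open Scope ereal_scope.

(* The [locally_integrable] of the library is for functions on R only. *)
Definition loc_integrable Omega u : Prop :=
  measurable_fun (Omega : set (Rn R N)) (u : Rn R N -> R) /\
  forall K : set 'rV[R]_N, compact K -> K `<=` Omega ->
    \int[leb R N]_(x in K) `|u x|%R%:E < +oo.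

Definition weak_gradient Omega u G : Prop :=
  [/\ loc_integrable Omega u,
      forall i : 'I_N, loc_integrable Omega (fun x => G x 0%R i) &
      forall (phi : 'rV[R]_N -> R) (i : 'I_N), test_function Omega phi ->
        \int[leb R N]_(x in Omega) (u x * partial i phi x)%:E =
        - \int[leb R N]_(x in Omega) (G x 0%R i * phi x)%:E].

(* [g] is the trace on the boundary of the W^{1,1} function [u] with weak
   gradient [G]: the trace operator is the extension by continuity, from W^{1,1}
   of the domain to L^1 of its boundary, of the restriction of smooth functions
   to the boundary. *)
Definition has_trace Omega u G (g : 'rV[R]_N -> R) : Prop :=
  exists phi : nat -> 'rV[R]_N -> R,
    [/\ forall k, smooth (phi k),
        (fun k => \int[leb R N]_(x in Omega) `|phi k x - u x|%R%:E) @ \oo --> 0,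
        forall i : 'I_N,
          (fun k => \int[leb R N]_(x in Omega)
                      `|partial i (phi k) x - G x 0 i|%R%:E) @ \oo --> 0 &
        (fun k => \int[hausdorff R N N.-1]_(x in boundary Omega)
                    `|phi k x - g x|%R%:E) @ \oo --> 0].

Definition modular Omega (Psi : 'rV[R]_N -> R -> R) u : \bar R :=
  \int[leb R N]_(x in Omega) (Psi x `|u x|%R)%:E.

Definition LPsi Omega (Psi : 'rV[R]_N -> R -> R) u : Prop :=
  measurable_fun (Omega : set (Rn R N)) (u : Rn R N -> R) /\
  modular Omega Psi u < +oo.

Definition norm_fun G : 'rV[R]_N -> R := fun x => enorm (G x).

(* Functions are representatives of their classes modulo equality almost
   everywhere, and the pair of [u] and its weak gradient [G] is carried
   along. *)
Definition W1Psi Omega (Psi : 'rV[R]_N -> R -> R) u G : Prop :=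
  [/\ LPsi Omega Psi u, weak_gradient Omega u G & LPsi Omega Psi (norm_fun G)].

Definition W1Psi0 Omega (Psi : 'rV[R]_N -> R -> R) u G : Prop :=
  W1Psi Omega Psi u G /\ has_trace Omega u G (fun=> 0%R).

Definition nonzero Omega u : Prop :=
  ~ {ae leb R N, forall x, Omega x -> u x = 0%R}.

Definition mean (B : set 'rV[R]_N) u : \bar R :=
  ((fine (leb R N B))^-1)%:E * \int[leb R N]_(x in B) (u x)%:E.

(* p-Muckenhoupt weights; the library balls of ['rV[R]_N] are the cubes with
   sides parallel to the axes. *)
Definition muckenhoupt (p : R) (w : 'rV[R]_N -> R) : Prop :=
  [/\ loc_integrable setT w,
      {ae leb R N, forall x, (0 < w x)%R} &
      exists C : R, forall (x : 'rV[R]_N) (r : R), (0 < r)%R ->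
        mean (ball x r) w *
        (mean (ball x r) (fun y => w y `^ (- (p - 1)^-1))%R) `^ (p - 1)
        <= C%:E].

End FunctionSpaces.

Section Problems.
Context (R : realType) (N : nat) (Omega : set 'rV[R]_N).
Implicit Types (a u : 'rV[R]_N -> R) (p q lam : R).
Local Open Scope ereal_scope.

Definition Theta p q a (x : 'rV[R]_N) (t : R) : R :=
  (a x * t `^ p + t `^ q)%R.

Definition Theta0 p a (x : 'rV[R]_N) (t : R) : R := (a x * t `^ p)%R.

Definition double_phase_eigenvalue p q a lam : Prop :=
  exists u G, [/\ W1Psi0 Omega (Theta p q a) u G, nonzero Omega u &
    forall h H, W1Psi0 Omega (Theta p q a) h H ->
      \int[leb R N]_(x in Omega)
        ((a x * enorm (G x) `^ (p - 2) + enorm (G x) `^ (q - 2)) *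
         dotv (G x) (H x))%:E =
      lam%:E * \int[leb R N]_(x in Omega)
        (a x * `|u x| `^ (p - 2) * u x * h x)%:E].

Definition weighted_eigenvalue p a lam : Prop :=
  exists u G, [/\ W1Psi0 Omega (Theta0 p a) u G, nonzero Omega u &
    forall h H, W1Psi0 Omega (Theta0 p a) h H ->
      \int[leb R N]_(x in Omega)
        (a x * enorm (G x) `^ (p - 2) * dotv (G x) (H x))%:E =
      lam%:E * \int[leb R N]_(x in Omega)
        (a x * `|u x| `^ (p - 2) * u x * h x)%:E].

Definition smallest_weighted_eigenvalue p a lam : Prop :=
  weighted_eigenvalue p a lam /\
  forall mu, weighted_eigenvalue p a mu -> (lam <= mu)%R.

Definition rayleigh_quotients p a : set (\bar R) :=
  [set y | exists u G, [/\ W1Psi0 Omega (Theta0 p a) u G, nonzero Omega u &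
    y = (fine (modular Omega (Theta0 p a) (norm_fun G)) /
         fine (modular Omega (Theta0 p a) u))%:E]]%R.

End Problems.

(* Main.v *)
(* Put P = int a |grad u|^p, Q = int |grad u|^q and U = int a |u|^p.
   Testing the equation with h = u gives P + Q = lam U, and the Rayleigh
   quotient of u gives lam1 U <= P, where P and U are nonzero because lam1 > 0
   (a vanishing U would make the quotient P / 0 = 0).
   Hence P + Q <= lam1 U <= P and Q = 0. As a is bounded,
   (a |grad u|^p)^(q/p) <= C |grad u|^q, so P = 0 as well, a contradiction. *)
Require Import Defs.
From mathcomp Require Import all_boot all_order all_algebra.
From mathcomp Require Import all_classical all_reals all_analysis.

Set Implicit Arguments.
Unset Strict Implicit.
Unset Printing Implicit Defensive.

Import Order.TTheory GRing.Theory Num.Theory.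
Import numFieldNormedType.Exports.

Local Open Scope classical_set_scope.
Local Open Scope ring_scope.

Section LowerIntegral.
Context d (T : measurableType d) (R : realType) (mu : {measure set T -> \bar R}).
Implicit Types (f g : T -> R) (D : set T).
Local Open Scope ereal_scope.
Import HBNNSimple.

Lemma nnsfun_le_restrict D f (h : {nnsfun T >-> R}) x :
  (h x)%:E <= ((EFin \o f) \_ D) x ->
  (D x /\ (h x <= f x)%R) \/ (~ D x /\ h x = 0%R).
Proof.
rewrite patchE; case: ifPn => [/set_mem Dx|/negP Dx]; rewrite lee_fin => hx.
  by left.
right; split; first by move=> ?; apply: Dx; exact: mem_set.
by apply/eqP; rewrite eq_le hx fun_ge0.
Qed.

(** The integral of a nonnegative function is a supremum over simple functions, and [h] is one of
    the competitors. The case [h x = 0] is allowed inside [D] too, so that a scaled indicator of a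
    subset of [D] qualifies. *)
Lemma sintegral_le_integral D f (h : {nnsfun T >-> R}) :
  (forall x, D x -> 0 <= f x)%R ->
  (forall x, (D x /\ (h x <= f x)%R) \/ h x = 0%R) ->
  sintegral mu h <= \int[mu]_(x in D) (f x)%:E.
Proof.
move=> f0 hf; rewrite ge0_integralE; last by move=> x /f0; rewrite lee_fin.
apply: ereal_sup_ubound; exists h => //= x; rewrite patchE.
have [[Dx hfx]|->] := hf x; first by rewrite mem_set// lee_fin.
by case: ifPn => // /set_mem /f0; rewrite lee_fin.
Qed.

Lemma integral_le_sintegral D f (M : \bar R) :
  (forall x, D x -> 0 <= f x)%R ->
  (forall h : {nnsfun T >-> R},
     (forall x, (D x /\ (h x <= f x)%R) \/ (~ D x /\ h x = 0%R)) ->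
     sintegral mu h <= M) ->
  \int[mu]_(x in D) (f x)%:E <= M.
Proof.
move=> f0 hM; rewrite ge0_integralE; last by move=> x /f0; rewrite lee_fin.
apply: ge_ereal_sup => _ [h hf <-]; apply: hM => x.
exact/nnsfun_le_restrict/hf.
Qed.

(* Unlike [ge0_le_integral], no measurability: the integral of a nonnegative
   function is a supremum over the simple functions below it. *)
Lemma le_lower_integral D f g :
  (forall x, D x -> 0 <= f x <= g x)%R ->
  \int[mu]_(x in D) (f x)%:E <= \int[mu]_(x in D) (g x)%:E.
Proof.
move=> fg; apply: integral_le_sintegral => [x /fg/andP[]//|h hf].
apply: sintegral_le_integral => [x /fg/andP[]|x]; first exact: le_trans.
have [[Dx hx]|[_ ->]] := hf x; last by right.
by left; split=> //; apply: le_trans hx _; have /andP[] := fg _ Dx.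
Qed.

(** If simple functions [h] and [k] lie below [f] and [g], then [h + k] is simple and lies below
    [f + g]. This half of additivity holds without measurability. *)
Lemma lower_integral_superadditive D f g :
  (forall x, D x -> 0 <= f x)%R -> (forall x, D x -> 0 <= g x)%R ->
  \int[mu]_(x in D) (f x)%:E + \int[mu]_(x in D) (g x)%:E <=
  \int[mu]_(x in D) (f x + g x)%:E.
Proof.
move=> f0 g0.
have fg0 x : D x -> (0 <= f x + g x)%R by move=> Dx; rewrite addr_ge0 ?f0 ?g0.
have [->|] := eqVneq (\int[mu]_(x in D) (f x + g x)%:E) +oo; first exact: leey.
rewrite -ltey => fgoo.
have Ifin f' : (forall x, D x -> 0 <= f' x)%R ->
    (forall x, D x -> f' x <= f x + g x)%R ->
    \int[mu]_(x in D) (f' x)%:E \is a fin_num.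
  move=> f'0 f'fg; rewrite ge0_fin_numE; last first.
    by apply: integral_ge0 => x /f'0; rewrite lee_fin.
  apply: le_lt_trans fgoo; apply: le_lower_integral => x Dx.
  by rewrite f'0// f'fg.
have gfin : \int[mu]_(x in D) (g x)%:E \is a fin_num.
  by apply: Ifin => // x Dx; rewrite lerDr f0.
(* With all quantities finite, one term at a time is moved to the right, so that the suprema over
   [h] and then over [k] are taken separately. *)
rewrite -leeBrDr//; apply: integral_le_sintegral => // h hf.
have hfin : sintegral mu h \is a fin_num.
  rewrite ge0_fin_numE; last exact: sintegral_ge0.
  apply: le_lt_trans fgoo; apply: sintegral_le_integral => // x.
  have [[Dx hx]|[_ ->]] := hf x; last by right.
  by left; split=> //; apply: le_trans hx _; rewrite lerDl g0.
rewrite leeBrDr// addeC -leeBrDr//.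
apply: integral_le_sintegral => // k kg.
rewrite leeBrDr// addeC -sintegralD//.
apply: (@sintegral_le_integral _ _ (add_nnsfun h k)) => // x /=.
have [[Dx hx]|[nDx ->]] := hf x; have [[Dx' kx]|[nDx' ->]] := kg x => //.
- by left; split=> //; exact: lerD.
- by right; rewrite addr0.
Qed.

Lemma lower_integral_powR_eq0 D f g (C r : R) :
  (0 < C)%R -> (0 < r)%R ->
  (forall x, D x -> 0 <= f x)%R -> (forall x, D x -> 0 <= g x)%R ->
  (forall x, D x -> f x `^ r <= C * g x)%R ->
  \int[mu]_(x in D) (g x)%:E = 0 -> \int[mu]_(x in D) (f x)%:E = 0.
Proof.
move=> C0 r0 f0 g0 fg Ig; apply/eqP; rewrite eq_le; apply/andP; split; last first.
  by apply: integral_ge0 => x /f0; rewrite lee_fin.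
apply: integral_le_sintegral => // h hf.
rewrite sintegralE fsbig1// => c _.
have [->|c0] := eqVneq c 0%R; first by rewrite mul0e.
have [cneg|cpos] := leP c 0%R.
  rewrite preimage_nnfun0 ?measure0 ?mule0//.
  by rewrite lt_neqAle c0.
have mA : measurable (h @^-1` [set c]) by [].
have e0 : (0 < c `^ r / C)%R by rewrite divr_gt0// powR_gt0.
(* Where [h x = c], one has [c <= f x], so [c]^ r <= f x [^ r <= C * g x]: the scaled indicator lies
   below [g]. *)
have : sintegral mu (scale_nnsfun (indic_nnsfun R mA) (ltW e0)) <= 0.
  rewrite -Ig; apply: sintegral_le_integral => // x /=; rewrite measurable_realfun.mindicE.
  have [hx|_] := boolP (_ \in _); last by right; rewrite mulr0.
  move/set_mem: hx => /= hx; left.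
  have [[Dx hfx]|[_ hx0]] := hf x; last by rewrite -hx hx0 eqxx in c0.
  split=> //; rewrite mulr1 ler_pdivrMr// mulrC; apply: le_trans (fg _ Dx).
  by rewrite ge0_ler_powR ?nnegrE ?(ltW r0) ?(ltW cpos) ?f0// -hx.
rewrite [X in X <= _](_ : _ = (c `^ r / C)%:E * mu (h @^-1` [set c])); last first.
  rewrite -sintegral_indic -[\1_ _]/(indic_nnsfun R mA : T -> R).
  by rewrite -sintegralrM.
rewrite pmule_rle0// => mA0; suff -> : mu (h @^-1` [set c]) = 0 by rewrite mule0.
by apply/eqP; rewrite eq_le mA0/=.
Qed.

End LowerIntegral.

Lemma dotv_enorm (R : realType) (N : nat) (v : 'rV[R]_N) :
  dotv v v = enorm v ^+ 2.
Proof.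
rewrite /enorm sqr_sqrtr// /dotv; apply: sumr_ge0 => i _.
by rewrite -expr2 sqr_ge0.
Qed.

(** At [t = 0] the power with exponent [r - 2] is a default value (0, or 1 if [r = 2]), which the
    factor [t ^+ 2] annihilates. This covers zeros of the gradient when [q < 2]. *)
Lemma powR_subr2 (R : realType) (t r : R) : 0 <= t -> r != 0 ->
  t `^ (r - 2) * t ^+ 2 = t `^ r.
Proof.
move=> t0 r0; have [->|tn0] := eqVneq t 0.
  by rewrite expr0n/= mulr0 powR0.
by rewrite -powR_mulrn// -powRD ?subrK// tn0 implybT.
Qed.

(** Values are compared with the one at a fixed [x0] in [A]; two points of [A] are at distance at
    most [M + M]. *)
Lemma lipschitz_bounded (K : numFieldType) (V W : normedModType K) (f : V -> W)
    (A : set V) : bounded_set A -> [lipschitz f x | x in A] ->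
  [bounded f x | x in A].
Proof.
have [->|/set0P[x0 Ax0]] := eqVneq A set0.
  by move=> _ _; exists 0; split=> [|M _ x []]; rewrite ?real0.
move=> /ex_strict_bound_gt0[M M0 AM] /pinfty_ex_gt0[k k0 flip].
have FA := globally_properfilter Ax0.
apply/ex_bound; exists (k * (M + M) + `|f x0|) => x Ax /=.
rewrite -[f x](subrK (f x0)); apply: le_trans (ler_normD _ _) _.
rewrite lerD2r; apply: le_trans (flip (x, x0) (conj Ax Ax0)) _ => /=.
rewrite ler_pM2l//; apply: le_trans (ler_normB _ _) _.
by rewrite lerD// ltW// AM.
Qed.

Theorem proposition3p2 (R : realType) (N : nat) (Omega : set 'rV[R]_N)
  (p q : R) (a : 'rV[R]_N -> R) (lam1 lam : R)
  (hOmega : bounded_domain Omega) (hbd : lipschitz_boundary Omega)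
  (hq : 1 < q) (hqp : q < p) (hpN : p < N%:R)
  (hpq : p / q < 1 + N%:R^-1)
  (ha_lip : [lipschitz a x | x in closure Omega])
  (ha_Ap : exists w : 'rV[R]_N -> R,
     muckenhoupt p w /\ forall x, Omega x -> a x = w x)
  (ha_pos : forall x, Omega x -> 0 < a x)
  (hlam1 : smallest_weighted_eigenvalue Omega p a lam1)
  (hlam1_inf : lam1%:E = ereal_inf (rayleigh_quotients Omega p a))
  (hlam0 : 0 < lam) (hlam : lam <= lam1) :
  ~ double_phase_eigenvalue Omega p q a lam.
Proof.
case=> u [G [uG u0 /(_ u G uG) weq]].
have q0 : 0 < q by apply: lt_trans hq.
have p0 : 0 < p by apply: lt_trans hqp.
have a0 x : Omega x -> 0 <= a x by move=> /ha_pos /ltW.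
have enorm0 (v : 'rV[R]_N) : 0 <= enorm v by exact: sqrtr_ge0.
pose P := modular Omega (Theta0 p a) (norm_fun G).
pose U := modular Omega (Theta0 p a) u.
pose Q := (\int[leb R N]_(x in Omega) (enorm (G x) `^ q)%:E)%E.
(* The weak equation tested with [u] itself, with both integrands rewritten as modulars. *)
have {}weq : modular Omega (Theta p q a) (norm_fun G) = (lam%:E * U)%E.
  transitivity (\int[leb R N]_(x in Omega)
      ((a x * enorm (G x) `^ (p - 2) + enorm (G x) `^ (q - 2)) *
       dotv (G x) (G x))%:E)%E.
    apply: eq_integral => x _; congr EFin.
    rewrite /Theta /norm_fun ger0_norm// dotv_enorm mulrDl -mulrA.
    by rewrite !powR_subr2// gt_eqF.
  rewrite weq; congr (_ * _)%E; apply: eq_integral => x _; congr EFin.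
  rewrite /Theta0 -(@powR_subr2 _ `|u x| p) ?gt_eqF//.
  by rewrite real_normK ?num_real// expr2 !mulrA.
have le_Theta f : (modular Omega (Theta0 p a) f <= modular Omega (Theta p q a) f)%E.
  apply: (le_lower_integral (leb R N)) => x Ox; rewrite /Theta0 /Theta.
  by rewrite mulr_ge0 ?powR_ge0 ?a0//= lerDl powR_ge0.
(* Since [Theta0] lies below [Theta], the pair [u], [G] is admissible in the Rayleigh quotient. *)
have uG0 : W1Psi0 Omega (Theta0 p a) u G.
  move: uG => [[[mu ru] wg [mG rG]] tr]; split=> //; split=> //.
  - by split=> //; exact: le_lt_trans ru.
  - by split=> //; exact: le_lt_trans rG.
have U0 : (0 <= U)%E.
  by apply: integral_ge0 => x Ox; rewrite lee_fin mulr_ge0 ?powR_ge0 ?a0.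
have P0 : (0 <= P)%E.
  by apply: integral_ge0 => x Ox; rewrite lee_fin mulr_ge0 ?powR_ge0 ?a0.
have Q0 : (0 <= Q)%E.
  by apply: integral_ge0 => x Ox; rewrite lee_fin powR_ge0.
have Ufin : U \is a fin_num by rewrite ge0_fin_numE//; case: uG0 => -[[]].
have Pfin : P \is a fin_num by rewrite ge0_fin_numE//; case: uG0 => -[_ _ []].
have PQ : (P + Q <= lam%:E * U)%E.
  rewrite -weq; apply: le_trans (lower_integral_superadditive _ _ _) _.
  - by move=> x Ox; rewrite mulr_ge0 ?powR_ge0 ?a0.
  - by move=> x Ox; rewrite powR_ge0.
  - rewrite le_eqVlt; apply/orP; left; apply/eqP; apply: eq_integral => x _.
    by rewrite /Theta /Theta0 /norm_fun ger0_norm.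
have quot : lam1 <= fine P / fine U.
  rewrite -lee_fin hlam1_inf; apply: ereal_inf_lbound.
  by exists u, G.
have quot_gt0 : 0 < fine P / fine U.
  by apply: lt_le_trans quot; exact: lt_le_trans hlam.
have fU0 : 0 < fine U.
  rewrite lt_neqAle fine_ge0// andbT; apply/eqP => U00.
  by rewrite -U00 invr0 mulr0 ltxx in quot_gt0.
have fP0 : 0 < fine P by move: quot_gt0; rewrite pmulr_lgt0 ?invr_gt0.
(* The finite [P] is cancelled from [P + Q <= lam * U <= P]; the last inequality is
   [lam <= lam1 <= P / U]. *)
have QE0 : Q = 0%E.
  apply/eqP; rewrite eq_le Q0 andbT -(@leeD2lE _ P)// adde0.
  apply: le_trans PQ _; rewrite -(fineK Ufin) -(fineK Pfin) -EFinM lee_fin.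
  rewrite -ler_pdivlMr//; exact: le_trans quot.
have [M M0 aM] : exists2 M, 0 < M & forall x, Omega x -> a x <= M.
  have [_ _ _ bO] := hOmega.
  have /(lipschitz_bounded bO)/ex_strict_bound_gt0[M M0 aM] :
      [lipschitz a x | x in Omega].
    apply: sub_lipschitz ha_lip => A /= AO [x y] [/= Ox Oy].
    by apply: AO; split; exact: subset_closure.
  by exists M => // x /aM /ltW; apply: le_trans; exact: ler_norm.
suff PE0 : P = 0%E by rewrite PE0 ltxx in fP0.
(* The exponent [q / p] turns [a * t]^ p[into]a [^ (q / p) * t]^ q[, and]a <= M[gives the constant]M
   [^ (q / p)]. *)
apply: (@lower_integral_powR_eq0 _ _ _ (leb R N) _ _
  (fun x => enorm (G x) `^ q) (M `^ (q / p)) (q / p)) => //.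
- by rewrite powR_gt0.
- by rewrite divr_gt0.
- by move=> x Ox; rewrite mulr_ge0 ?powR_ge0 ?a0.
- by move=> x Ox; rewrite powR_ge0.
move=> x Ox; rewrite /Theta0 /norm_fun ger0_norm//.
rewrite powRM ?powR_ge0 ?a0// -powRrM mulrCA divff ?gt_eqF// mulr1.
rewrite ler_wpM2r ?powR_ge0// ge0_ler_powR ?nnegrE ?a0 ?aM ?(ltW M0)//.
by rewrite ltW// divr_gt0.
Qed.
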